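(* Let $f:\mathbb{R}^n\to\mathbb{R}^n$ be locally Lipschitz continuous, $\beta\in\mathbb{N}$, $\lambda>0$, and let $W_{\lambda,\beta}$ be the function defined in the context. Suppose there exist $R,\eta>0$ such that $ROA_f\subset B_R(0)$ and $B_\eta(0)$ is an exponentially stable set of the ODE $\dot x=f(x)$. Then: 1. For any sequence $\{x_k\}_{k\in\mathbb{N}}\subset ROA_f$ such that $\lim_{k\to\infty}x_k\in\partial ROA_f$, we have $\lim_{k\to\infty}W_{\lambda,\beta}(x_k)=1$. 2. $ROA_f=\{x\in\mathbb{R}^n:W_{\lambda,\beta}(x)<1\}$.
   Context: Standing assumptions: $f(0)=0$, and the ODE $\dot x(t)=f(x(t))$, $x(0)=x_0$, has a unique solution map $\phi_f(x,t)$ defined for all $(x,t)\in\mathbb{R}^n\times[0,\infty)$, i.e. $\frac{\partial}{\partial t}\phi_f(x,t)=f(\phi_f(x,t))$, $\phi_f(x,0)=x$, and $\phi_f(\phi_f(x,t),s)=\phi_f(x,t+s)$. $B_r(y)=\{x\in\mathbb{R}^n:\|x-y\|_2<r\}$; $\partial$ denotes the topological boundary; $\beta$ is a positive integer. Region of attraction: $ROA_f=\{x\in\mathbb{R}^n:\lim_{t\to\infty}\|\phi_f(x,t)\|_2=0\}$. Exponentially stable set: a set $U\subset\mathbb{R}^n$ that contains a neighborhood of the origin and for which there exist $\delta,\mu>0$ such that for every $x\in U$: $\phi_f(x,t)\in U$ for all $t\ge0$, $\lim_{t\to\infty}\phi_f(x,t)=0$, and $\|\phi_f(x,t)\|_2\le\mu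 e^{-\delta t}\|x\|_2$ for all $t\ge0$. $W_{\lambda,\beta}(x)=1-\exp\left(-\lambda\int_0^\infty\|\phi_f(x,t)\|_2^{2\beta}\,dt\right)$ if $x\in ROA_f$, and $W_{\lambda,\beta}(x)=1$ otherwise. *)

(* Defs.v *)
From mathcomp Require Export all_boot all_order all_algebra.
From mathcomp Require Export all_classical all_reals all_analysis.
Export numFieldNormedType.Exports.
Export Order.TTheory GRing.Theory Num.Theory.

Set Implicit Arguments.
Unset Strict Implicit.
Unset Printing Implicit Defensive.

Local Open Scope classical_set_scope.
Local Open Scope ring_scope.

(* Euclidean norm; the norm that the library puts on ['rV[R]_n] is the sup
   norm, which induces the same topology. *)
Definition enorm (R : realType) (n : nat) (x : 'rV[R]_n) : R :=
  Num.sqrt (\sum_(i < n) x 0 i ^+ 2).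

Definition eball (R : realType) (n : nat) (y : 'rV[R]_n) (r : R) :
  set 'rV[R]_n := [set x | enorm (x - y) < r].

Definition boundary (T : topologicalType) (A : set T) : set T :=
  closure A `\` A°.

(* The Lipschitz estimate is in the sup norm. As all norms on R^n are
   equivalent, the choice only affects the constant. *)
Definition locally_lipschitz (R : realType) (n : nat)
    (f : 'rV[R]_n -> 'rV[R]_n) : Prop :=
  forall x : 'rV[R]_n, exists2 U, nbhs x U & [lipschitz f z | z in U].

(* [y] is a solution on [0, +oo[ of y' = f(y), y(0) = x0, with a one-sided
   derivative at 0. The values of [y] at negative times are irrelevant. *)
Definition is_solution (R : realType) (n : nat) (f : 'rV[R]_n -> 'rV[R]_n)
    (x0 : 'rV[R]_n) (y : R -> 'rV[R]_n) : Prop :=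
  [/\ y 0 = x0,
      h^-1 *: (y h - y 0) @[h --> (0 : R)^'+] --> f (y 0) &
      forall t : R, 0 < t -> is_derive t 1 y (f (y t))].

Definition is_solution_map (R : realType) (n : nat)
    (f : 'rV[R]_n -> 'rV[R]_n) (phi : 'rV[R]_n -> R -> 'rV[R]_n) : Prop :=
  [/\ forall x, is_solution f x (phi x),
      forall x (t s : R), 0 <= t -> 0 <= s ->
        phi (phi x t) s = phi x (t + s) &
      forall x y, is_solution f x y -> forall t : R, 0 <= t -> y t = phi x t].

Definition ROA (R : realType) (n : nat) (phi : 'rV[R]_n -> R -> 'rV[R]_n) :
  set 'rV[R]_n := [set x | enorm (phi x t) @[t --> +oo] --> (0 : R)].

Definition exp_stable_set (R : realType) (n : nat)
    (phi : 'rV[R]_n -> R -> 'rV[R]_n) (U : set 'rV[R]_n) : Prop :=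
  nbhs (0 : 'rV[R]_n) U /\
  exists delta mu : R, [/\ 0 < delta, 0 < mu &
    forall x, U x ->
      [/\ forall t : R, 0 <= t -> U (phi x t),
          phi x t @[t --> +oo] --> (0 : 'rV[R]_n) &
          forall t : R, 0 <= t ->
            enorm (phi x t) <= mu * expR (- (delta * t)) * enorm x]].

(* The integral lives in the extended reals: should it be [+oo], then
   [expeR -oo = 0] and the value is 1. *)
Definition W (R : realType) (n : nat) (phi : 'rV[R]_n -> R -> 'rV[R]_n)
    (lambda : R) (beta : nat) (x : 'rV[R]_n) : R :=
  if x \in ROA phi then
    1 - fine (expeR (- (lambda%:E *
      \int[lebesgue_measure]_(t in `[0%R, +oo[)
        (enorm (phi x t) ^+ (2 * beta))%:E))%E)
  else 1.

(* Main.v *)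
Require Import Defs.
From mathcomp Require Import ring lra measurable_realfun.

(** Two facts carry the theorem.

    First, the region of attraction is open, by continuous dependence on the
    initial state: if [l] is attracted to [0], its trajectory is inside the
    ball [eball 0 eta] at some finite time, hence so is the trajectory of
    every nearby point, and whatever enters that ball converges to [0]
    ([enter_ball_ROA], [ROA_open]). Consequently a boundary point [l] of the
    region is not in the region, and its whole trajectory stays at distance at
    least [eta] from [0]. Using continuous dependence again on a long interval
    [0, T], the trajectories of all points close to [l] stay away from [0] by
    a fixed amount during a time [T] ([flow_away_from_0]). The integral that
    defines [W] is then at least a constant times [T]; as [T] is arbitrary,
    it tends to infinity along [x k], that is, [W] tends to [1].

    Second, the integral is finite on the region of attraction: after its
    entry in the ball a trajectory decays exponentially, and before that it
    is bounded, being continuous ([ROA_exp_decay], [cost_lty]). So [W < 1]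
    there, whereas [W = 1] elsewhere by definition.

    Continuous dependence ([flow_continuous_dependence]) rests on a Gronwall
    estimate. The vector field is only locally Lipschitz and a trajectory that
    starts near [l] is not known to be bounded beforehand, so the Lipschitz
    estimate is available only in a tube around the compact arc of the
    trajectory of [l] ([compact_locally_lipschitz]); [gronwall_tube] shows
    that a perturbed trajectory does not leave the tube. Estimates on vector
    fields and compactness use the sup norm, while the quantity being
    differentiated is the squared Euclidean norm, which is smooth. *)

Local Open Scope classical_set_scope.
Local Open Scope ring_scope.

(** * The Euclidean norm and the sup norm *)

Section Enorm.
Context {R : realType} {n : nat}.
Implicit Types x : 'rV[R]_n.

Lemma enorm_ge0 x : 0 <= enorm x.
Proof. exact: sqrtr_ge0. Qed.

Lemma sqr_enorm x : enorm x ^+ 2 = \sum_(i < n) x 0 i ^+ 2.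
Proof. by rewrite sqr_sqrtr// sumr_ge0// => i _; exact: sqr_ge0. Qed.

Lemma enorm0 : enorm (0 : 'rV[R]_n) = 0.
Proof.
apply/eqP; rewrite -sqrf_eq0 sqr_enorm big1// => i _.
by rewrite mxE expr0n.
Qed.

Lemma coord_le_normr x i : `|x 0 i| <= `|x|.
Proof.
rewrite [leRHS]/Num.Def.normr/= mx_normrE.
exact: (le_bigmax _ (fun ij => `|x ij.1 ij.2|) (0, i)).
Qed.

Lemma normr_le_enorm x : `|x| <= enorm x.
Proof.
rewrite [leLHS]/Num.Def.normr/= mx_normrE (bigmax_le _ (enorm_ge0 x))//=.
move=> [i j] _ /=; rewrite ord1 -(ler_sqr (normr_ge0 _) (enorm_ge0 x)) sqr_enorm.
rewrite real_normK ?num_real// (bigD1 j)//= lerDl sumr_ge0// => k _.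
exact: sqr_ge0.
Qed.

Lemma sqr_enorm_le_normr x : enorm x ^+ 2 <= n%:R * `|x| ^+ 2.
Proof.
rewrite sqr_enorm (le_trans (ler_sum _ (fun i _ => _ : _ <= `|x| ^+ 2)))//.
  move=> i _; rewrite -(real_normK (num_real _)).
  by rewrite lerXn2r ?nnegrE ?coord_le_normr.
by rewrite sumr_const card_ord mulr_natl.
Qed.

Lemma enorm_le_normr x : enorm x <= n.+1%:R * `|x|.
Proof.
rewrite -ler_sqr ?nnegrE ?enorm_ge0 ?mulr_ge0//.
rewrite (le_trans (sqr_enorm_le_normr x))//.
rewrite exprMn ler_wpM2r ?sqr_ge0// -natrX ler_nat.
by rewrite (leq_trans (leqnSn n))// expnS leq_pmulr.
Qed.

Lemma enorm_continuous : continuous (@enorm R n).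
Proof.
move=> x.
apply: (continuous_comp (f := fun y : 'rV[R]_n => \sum_(i < n) y 0 i ^+ 2));
  last exact: sqrt_continuous.
apply: (continuous_big (op := +%R)); first exact: add_continuous.
move=> i _ {}x.
apply: (@cvg_comp _ _ _ (fun y : 'rV[R]_n => y 0 i) (fun a => a ^+ 2)).
  exact: coord_continuous.
exact: exprn_continuous.
Qed.

End Enorm.

(** * Gronwall estimate in a tube *)

Lemma is_derive_coord {R : realType} {n : nat} (u : R -> 'rV[R]_n) (t : R)
    (v : 'rV[R]_n) (i : 'I_n) :
  is_derive t 1 u v -> is_derive t 1 (fun s => u s 0 i) (v 0 i).
Proof.
move=> [du <-]; split; first by move/derivable_mxP : du; exact.
by rewrite derive_mx// mxE.
Qed.

Lemma is_derive_sqr_enorm {R : realType} {n : nat} (u : R -> 'rV[R]_n) (t : R)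
    (v : 'rV[R]_n) :
  is_derive t 1 u v ->
  is_derive t 1 (fun s => enorm (u s) ^+ 2) (\sum_(i < n) 2 * u t 0 i * v 0 i).
Proof.
move=> du.
rewrite (_ : (fun _ => _) = \sum_(i < n) ((fun s => u s 0 i) ^+ 2)); last first.
  by apply/funext => s; rewrite sqr_enorm fct_sumE.
apply: is_derive_sum => i; have dui := is_derive_coord _ _ _ i du.
by apply: is_derive_eq.
Qed.

Lemma within_closed_superlevel {R : realType} (a b c : R) (g : R -> R) :
  {within `[a, b], continuous g} ->
  closed [set t | a <= t <= b /\ c <= g t].
Proof.
move=> /continuous_closedP/(_ [set y | c <= y] (@closed_ge _ c)).
move=> /closed_subspaceP[V cV VE].
suff -> : [set t | a <= t <= b /\ c <= g t] = V `&` `[a, b].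
  by apply: closedI => //; exact: itv_closed.
by rewrite VE; apply/seteqP; split => t /=; rewrite in_itv/= => -[? ?].
Qed.

(** The differential inequality [`|u'| <= L `|u|] is assumed only while [u] is
    in the ball of radius [e]. Up to the first exit time from that ball it
    gives [enorm (u t) ^+ 2 <= enorm (u 0) ^+ 2 * expR (2 n L t)], because the
    derivative [2 <u, u'>] of the squared norm is at most [2 n L] times the
    squared norm; the smallness of [u 0] then makes an exit impossible. The
    factor [n] is the price of the sup norm in the hypothesis. *)
Lemma gronwall_tube {R : realType} {n : nat} (u v : R -> 'rV[R]_n)
    (T L e : R) :
  0 <= T ->
  0 <= e -> 0 <= L ->
  {within `[0, T], continuous (fun t => enorm (u t) ^+ 2)} ->
  (forall t, 0 < t < T -> is_derive t 1 u (v t)) ->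
  (forall t, 0 < t < T -> enorm (u t) < e -> `|v t| <= L * `|u t|) ->
  enorm (u 0) ^+ 2 * expR (2 * n%:R * L * T) < e ^+ 2 ->
  forall t, 0 <= t <= T -> enorm (u t) < e.
Proof.
move=> T0 e0 L0 cu du vL small t1 t1T.
set E := fun t => enorm (u t) ^+ 2.
set K := 2 * n%:R * L.
have K0 : 0 <= K by rewrite !mulr_ge0.
have growth s : 0 <= s <= T -> (forall t, 0 < t < s -> enorm (u t) < e) ->
    E s <= E 0 * expR (K * s).
  move=> /andP[s0 sT] us.
  pose h := fun t => E t * expR (- (K * t)).
  have dh t : 0 < t < s -> is_derive t 1 h
      ((\sum_(i < n) 2 * u t 0 i * v t 0 i - K * E t) * expR (- (K * t))).
    move=> /andP[t0 ts].
    have tT : 0 < t < T by rewrite t0 (lt_le_trans ts).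
    have dE : is_derive t 1 E _ := is_derive_sqr_enorm _ _ _ (du t tT).
    have dm : is_derive t 1 (fun t : R => - (K * t)) (- K).
      by apply: is_derive_eq; rewrite /GRing.scale/= ?mulr1 ?mulr0 ?addr0.
    have de := is_derive1_comp (is_derive_expR _) dm.
    have := is_deriveM dE de.
    move=> /(@is_derive_eq _ _ _ _ _ _ _ _); apply.
    rewrite /GRing.scale/=; ring.
  have dh0 t : 0 < t < s -> (h^`())%classic t <= 0.
    move=> ts; have dht := dh t ts; rewrite derive1E derive_val.
    have [t0 ts'] := andP ts.
    rewrite pmulr_lle0 ?expR_gt0// subr_le0.
    have tT : 0 < t < T by rewrite t0 (lt_le_trans ts').
    have uv := vL t tT (us t ts).
    apply: (@le_trans _ _ (\sum_(i < n) 2 * `|u t| * (L * `|u t|))).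
      apply: ler_sum => i _; rewrite (le_trans (ler_norm _))// !normrM normr_nat.
      rewrite ler_pM ?mulr_ge0 ?ler_wpM2l ?coord_le_normr//.
      by rewrite (le_trans (coord_le_normr _ _)).
    rewrite sumr_const card_ord -[leLHS]mulr_natl.
    rewrite (_ : n%:R * _ = K * `|u t| ^+ 2); last by rewrite /K; ring.
    by rewrite ler_wpM2l// lerXn2r ?nnegrE ?enorm_ge0 ?normr_le_enorm.
  have hs : h s <= h 0.
    apply: (@ler0_derive1_le_cc R h 0 s) .
    - by move=> t /[!in_itv]/= ts; have [] := dh t ts.
    - by move=> t /[!in_itv]/= ts; exact: dh0.
    - have cE : {within `[0, s], continuous E}.
        apply: continuous_subspaceW cu => t/=.
        by rewrite !in_itv/= => /andP[-> /le_trans->].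
      move=> t; apply: continuousM; first exact: cE.
      apply: (@continuous_subspaceT _ _ _ (fun t => expR (- (K * t)))) => {}t.
      apply: continuous_comp; last exact: continuous_expR.
      by apply: continuousN; apply: mulrl_continuous.
    - by rewrite in_itv/= lexx s0.
    - by rewrite in_itv/= lexx s0.
    - exact: s0.
  move: hs; rewrite /h mulr0 oppr0 expR0 mulr1 expRN.
  by rewrite ler_pdivrMr ?expR_gt0.
(* If [u] leaves the ball, let [t] be the first time it does. *)
set A := [set t | 0 <= t <= T /\ e ^+ 2 <= E t].
have cA : closed A by exact: within_closed_superlevel.
rewrite ltNge; apply/negP => eu.
have At1 : A t1 by split => //; rewrite lerXn2r ?nnegrE ?enorm_ge0.
have kA : compact A.
  apply: (subclosed_compact cA (@segment_compact _ 0 T)) => t [tT _] /=.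
  by rewrite in_itv/=.
have [|t /set_mem[tT et] mint] :=
  compact_EVT_min (f := id) (ex_intro _ t1 At1) kA.
  by apply: continuous_subspaceT => ?; exact: cvg_id.
have Et : E t <= E 0 * expR (K * t).
  apply: growth => // s /andP[s0 st]; rewrite ltNge; apply/negP => es.
  suff /mint : s \in A by rewrite leNgt st.
  apply/mem_set; split; last by rewrite lerXn2r ?nnegrE ?enorm_ge0.
  by case/andP : tT => _ /(lt_le_trans st)/ltW ->; rewrite (ltW s0).
have : E t < e ^+ 2.
  apply: le_lt_trans small; rewrite (le_trans Et)//.
  rewrite ler_wpM2l ?sqr_ge0// ler_expR ler_wpM2l//.
  by case/andP : tT.
by rewrite ltNge et.
Qed.

(** * Continuous dependence on the initial state *)

(** Only one of the two points has to be in [K]: the constant holds in a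
    neighbourhood of [K] of uniform width. A single parameter [L] serves as
    Lipschitz constant and as inverse of the width, so that the statement is
    local validity for all large [L] extends to [K] by compactness. *)
Lemma compact_locally_lipschitz {R : realType} {n : nat}
    (f : 'rV[R]_n -> 'rV[R]_n) (K : set 'rV[R]_n) :
  locally_lipschitz f -> compact K ->
  exists2 L : R, 0 < L & forall p y, K p -> `|y - p| < L^-1 ->
    `|f y - f p| <= L * `|y - p|.
Proof.
move=> flip /compact_near_coveringP cK.
pose P (L : R) p := forall y, `|y - p| < L^-1 -> `|f y - f p| <= L * `|y - p|.
suff : \forall L \near +oo, K `<=` P L.
  move=> KP; near (+oo : set_system R) => L; exists L.
    by near: L; exact: nbhs_pinfty_gt.
  by move=> p y Kp; have := (near KP L _) p Kp y; apply.
apply: cK => x Kx.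
have [U /nbhs_ballP[r /= r0 rU] lipU] := flip x.
near=> p L => y yp.
have L0 : 0 < L by near: L; exact: nbhs_pinfty_gt.
have Lr : 2 / r < L by near: L; apply: nbhs_pinfty_gt; exact: num_real.
have Lr2 : L^-1 < r / 2 by rewrite -[ltRHS]invf_div ltf_pV2 ?posrE ?divr_gt0.
have px : `|x - p| < r / 2 by near: p; apply: cvgr_dist_lt; rewrite // divr_gt0.
have /(_ (y, p))/= : L.-lipschitz_U f by near: L.
apply; split => /=; apply: rU; rewrite -ball_normE /ball_/=; last first.
  by rewrite (lt_trans px)// ltr_pdivrMr// ltr_pMr// ltr1n.
rewrite (_ : x - y = (x - p) - (y - p)); last by rewrite opprB addrA subrK.
rewrite (le_lt_trans (ler_normB _ _))// (splitr r) ltrD//.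
exact: lt_trans Lr2.
Unshelve. all: by end_near. Qed.

Section Flow.
Context {R : realType} {n : nat} (f : 'rV[R]_n -> 'rV[R]_n).
Context (phi : 'rV[R]_n -> R -> 'rV[R]_n) (phi_sol : is_solution_map f phi).
Implicit Types (x l : 'rV[R]_n) (t T : R).

Lemma flow0 x : phi x 0 = x.
Proof. by have [/(_ x)[]] := phi_sol. Qed.

Lemma flowD x t s : 0 <= t -> 0 <= s -> phi (phi x t) s = phi x (t + s).
Proof. by have [_ + _] := phi_sol; apply. Qed.

Lemma flow_is_derive x (t : R) : 0 < t -> is_derive t 1 (phi x) (f (phi x t)).
Proof. by have [/(_ x)[_ _ + _ _]] := phi_sol; apply. Qed.

Lemma flow_continuous x : {within `[0, +oo[, continuous (phi x)}.
Proof.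
apply/continuous_within_itvcyP; split.
  move=> t /[!in_itv]/= /andP[t0 _].
  apply/differentiable_continuous/derivable1_diffP.
  by have [] := flow_is_derive x _ t0.
have [/(_ x)[_ dphi0 _] _ _] := phi_sol.
(* At [0] there is only a right derivative, which still gives right
   continuity. *)
have : phi x 0 + h *: (h^-1 *: (phi x h - phi x 0)) @[h --> 0^'+] -->
    phi x 0 + 0 *: f (phi x 0).
  apply: cvgD; first exact: cvg_cst.
  apply: cvgZ => //; apply: cvg_at_right_filter; exact: cvg_id.
rewrite scale0r addr0; apply: cvg_trans; apply: near_eq_cvg; near=> h.
rewrite scalerA divff ?scale1r ?subrKC//.
Unshelve. all: by end_near. Qed.

Lemma enorm_flow_continuous x :
  {within `[0, +oo[, continuous (fun t => enorm (phi x t))}.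
Proof.
apply: (within_continuous_comp _ (phi x) (@enorm R n)).
  by move=> y _; exact: enorm_continuous.
exact: flow_continuous.
Qed.

Lemma flow_continuous_dependence (l : 'rV[R]_n) (T e : R) : locally_lipschitz f ->
  0 <= T -> 0 < e ->
  \forall x \near l, forall t, 0 <= t <= T -> enorm (phi x t - phi l t) < e.
Proof.
move=> flip T0 e0.
have sub0T : `[0, T] `<=` (`[0, +oo[ : set R).
  by move=> t /=; rewrite !in_itv/= => /andP[->].
have cl := continuous_subspaceW sub0T (flow_continuous l).
have [L L0 KL] := compact_locally_lipschitz _ _ flip
  (continuous_compact cl (@segment_compact _ 0 T)).
(* The radius of the tube: it must fit both the target [e] and the width in
   which [f] is Lipschitz around the trajectory of [l]. *)
pose d := Num.min e L^-1.
have d0 : 0 < d by rewrite lt_min e0 invr_gt0.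
near=> x => t tT; apply: (@lt_le_trans _ _ d); last by rewrite ge_min lexx.
apply: (@gronwall_tube _ _ (fun t => phi x t - phi l t)
  (fun t => f (phi x t) - f (phi l t)) T L d) => //.
- exact: ltW.
- exact: ltW.
- apply: (continuous_subspaceW sub0T).
  apply: (within_continuous_comp _ (fun t => phi x t - phi l t)
    (fun y => enorm y ^+ 2)).
    move=> y _; exact: (continuous_comp (enorm_continuous y)
      (@exprn_continuous R 2 _)).
  move=> s; apply: continuousB; exact: flow_continuous.
- by move=> s /andP[s0 _]; apply: is_deriveB; exact: flow_is_derive.
- move=> s /andP[s0 sT] xs; apply: KL.
    by exists s => //=; rewrite in_itv/= !ltW.
  rewrite (le_lt_trans (normr_le_enorm _))// (lt_le_trans xs)//.
  by rewrite ge_min lexx orbT.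
rewrite !flow0.
near: x.
pose F (x : 'rV[R]_n) := enorm (x - l) ^+ 2 * expR (2 * n%:R * L * T).
have cF : {for l, continuous F}.
  apply: continuousM; last exact: cst_continuous.
  apply: (@continuous_comp _ _ _ (fun x : 'rV[R]_n => x - l)
    (fun y => enorm y ^+ 2)).
    by apply: continuousB; [exact: cvg_id|exact: cst_continuous].
  exact: (continuous_comp (enorm_continuous _) (@exprn_continuous R 2 _)).
have Fl : F l = 0 by rewrite /F subrr enorm0 expr0n mul0r.
have := cF : F x @[x --> l] --> F l.
by rewrite Fl => /cvgr_lt; apply; rewrite exprn_gt0.
Unshelve. all: by end_near. Qed.

(** * The region of attraction *)

Section Stable.
Context (eta : R) (eta0 : 0 < eta) (stable : exp_stable_set phi (eball 0 eta)).

Lemma enter_ball_ROA x t : 0 <= t -> enorm (phi x t) < eta -> ROA phi x.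
Proof.
move=> t0 xt; have [_ [delta [mu [_ _ /(_ (phi x t))]]]] := stable.
rewrite /eball/= subr0 => /(_ xt)[_ + _].
move=> /(cvg_comp _ _)/(_ (enorm_continuous _)).
rewrite /ROA/= enorm0 => cv.
apply/cvgrPdist_lt => e e0.
have : \forall s \near +oo, `|0 - enorm (phi (phi x t) (s - t))| < e.
  by move/cvgrPdist_lt : cv => /(_ _ e0); exact: (cvg_addrr (- t)).
apply: filterS2 (nbhs_pinfty_ge (num_real t)) => s ts.
by rewrite flowD ?subr_ge0// subrKC.
Qed.

Lemma ROA_enter_ball x : ROA phi x -> exists2 t, 0 <= t & enorm (phi x t) < eta.
Proof.
move=> /cvgr_lt/(_ _ eta0) H; near (+oo : set_system R) => t; exists t.
  by near: t; exact: nbhs_pinfty_ge.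
by near: t.
Unshelve. all: by end_near. Qed.

Lemma ROA_open : locally_lipschitz f -> open (ROA phi).
Proof.
move=> flip; rewrite openE => l /ROA_enter_ball[t t0 lt].
have : \forall y \near phi l t, enorm y < eta.
  by have /cvgr_lt := @enorm_continuous R n (phi l t); apply.
move=> /nbhs_ballP[r /= r0 rlt].
have := flow_continuous_dependence l _ _ flip t0 r0.
apply: filterS => x /(_ t); rewrite t0 lexx => /(_ isT) xr.
apply: (enter_ball_ROA _ _ t0); apply: rlt.
rewrite -ball_normE /ball_/= distrC.
exact: le_lt_trans (normr_le_enorm _) xr.
Qed.

(** Exponential stability gives the decay only from the time at which the
    trajectory enters the ball. That time depends on [x], hence so does [C]. *)
Lemma ROA_exp_decay x : ROA phi x ->
  exists C r : R, [/\ 0 < C, 0 < r & forall t, 0 <= t ->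
    enorm (phi x t) <= C * expR (- (r * t))].
Proof.
move=> /ROA_enter_ball[T T0 xT].
have [_ [delta [mu [delta0 mu0 /(_ (phi x T))]]]] := stable.
rewrite /eball/= subr0 => /(_ xT)[_ _ decay].
have sub0T : `[0, T] `<=` (`[0, +oo[ : set R).
  by move=> t /=; rewrite !in_itv/= => /andP[->].
have [c _ cmax] :=
  EVT_max T0 (continuous_subspaceW sub0T (enorm_flow_continuous x)).
(* The maximum over [0, T] serves before [T], the bound [mu * eta] at the entry
   in the ball serves after [T]; the factor [expR (delta * T)] shifts the
   origin of time from [T] to [0]. *)
exists ((enorm (phi x c) + mu * eta) * expR (delta * T)), delta; split => //.
  by rewrite mulr_gt0 ?expR_gt0// ltr_wpDl ?enorm_ge0// mulr_gt0.
move=> t t0; rewrite -mulrA -expRD -mulrBr.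
have [tT|Tt] := leP t T.
  have /cmax/le_trans : t \in `[0, T] by rewrite in_itv/= t0.
  apply; rewrite -[leLHS]mulr1 ler_pM ?enorm_ge0//.
    by rewrite lerDl mulr_ge0// ltW.
  by rewrite -expR0 ler_expR mulr_ge0 ?subr_ge0// ltW.
have tT0 : 0 <= t - T by rewrite subr_ge0 ltW.
have := decay _ tT0; rewrite flowD// subrKC => /le_trans; apply.
rewrite -mulrN opprB mulrAC ler_wpM2r ?expR_ge0//.
rewrite (@le_trans _ _ (mu * eta))//; first by apply: ler_wpM2l; exact: ltW.
by rewrite lerDr enorm_ge0.
Qed.

(** * The cost integral and the function W *)

Lemma cost_measurable x (m : nat) :
  measurable_fun (`[0, +oo[ : set R) (fun t => enorm (phi x t) ^+ m).
Proof.
apply: measurable_funX; apply: subspace_continuous_measurable_fun => //.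
exact: enorm_flow_continuous.
Qed.

(** The integrand is dominated by [C ^+ m * expR (- (q * t))] with [q = m * r],
    a multiple of the density of the exponential law of rate [q]. It is here
    that the exponent must be positive: for [m = 0] the integrand is [1]. *)
Lemma cost_lty x (m : nat) : (0 < m)%N -> ROA phi x ->
  (\int[lebesgue_measure]_(t in `[0%R, +oo[) (enorm (phi x t) ^+ m)%:E < +oo)%E.
Proof.
move=> m0 /ROA_exp_decay[C [r [C0 r0 decay]]].
pose q := m%:R * r.
have q0 : 0 < q by rewrite mulr_gt0 ?ltr0n.
pose M := C ^+ m / q.
have M0 : 0 <= M by rewrite divr_ge0 ?exprn_ge0// ltW.
have mpdf D : measurable_fun D (EFin \o exponential_pdf q).
  by apply/measurable_EFinP/measurable_funTS; exact: measurable_exponential_pdf.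
apply: (@le_lt_trans _ _ M%:E); last exact: ltry.
apply: (@le_trans _ _ (\int[lebesgue_measure]_(t in `[0%R, +oo[)
    (M%:E * (exponential_pdf q t)%:E))%E).
  apply: ge0_le_integral => //.
  - by move=> t _; rewrite lee_fin exprn_ge0 ?enorm_ge0.
  - by apply/measurable_EFinP; exact: cost_measurable.
  - by apply: measurable_funeM; exact: mpdf.
  - move=> t /=; rewrite in_itv/= andbT => t0.
    rewrite -EFinM lee_fin exponential_pdfE// /M mulrA divfK ?lt0r_neq0//.
    apply: (@le_trans _ _ ((C * expR (- (r * t))) ^+ m)).
      by rewrite lerXn2r ?nnegrE ?enorm_ge0 ?mulr_ge0 ?expR_ge0 ?(ltW C0)// decay.
    by rewrite exprMn -expRM_natl /q mulrN mulNr mulrA.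
rewrite ge0_integralZl_EFin//; last 2 first.
  by move=> t _; rewrite lee_fin exponential_pdf_ge0// ltW.
  exact: mpdf.
rewrite -[leRHS]mule1 lee_wpmul2l ?lee_fin// -(integral_exponential_pdf q0).
apply: ge0_subset_integral => //; first exact: mpdf.
by move=> t _; rewrite lee_fin exponential_pdf_ge0// ltW.
Qed.

Lemma W_ROA lambda (beta : nat) x : (0 < beta)%N -> ROA phi x ->
  exists2 I : R,
    (\int[lebesgue_measure]_(t in `[0%R, +oo[)
        (enorm (phi x t) ^+ (2 * beta))%:E = I%:E)%E &
    W phi lambda beta x = 1 - expR (- (lambda * I)).
Proof.
move=> b0 xA; have m0 : (0 < 2 * beta)%N by rewrite muln_gt0.
have Ioo := cost_lty x _ m0 xA.
have I0 : (0 <= \int[lebesgue_measure]_(t in `[0%R, +oo[)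
    (enorm (phi x t) ^+ (2 * beta))%:E)%E.
  by apply: integral_ge0 => t _; rewrite lee_fin exprn_ge0 ?enorm_ge0.
rewrite /W mem_set//.
by move: Ioo I0; case: (integral _ _ _) => // I _ _; exists I.
Qed.

Lemma W_notin_ROA lambda beta x : ~ ROA phi x -> W phi lambda beta x = 1.
Proof. by move=> xA; rewrite /W memNset. Qed.

Lemma W_ROA_ge lambda (beta : nat) x (T a : R) : 0 <= lambda -> (0 < beta)%N ->
  ROA phi x -> 0 <= T -> 0 <= a ->
  (forall t, 0 <= t <= T -> a <= enorm (phi x t)) ->
  1 - expR (- (lambda * (a ^+ (2 * beta) * T))) <= W phi lambda beta x.
Proof.
move=> l0 b0 xA T0 a0 aphi; have [I IE ->] := W_ROA lambda beta x b0 xA.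
rewrite lerD2l lerN2 ler_expR lerN2 ler_wpM2l// -lee_fin -IE.
apply: (@le_trans _ _ (\int[lebesgue_measure]_(t in `[0%R, T])
  (enorm (phi x t) ^+ (2 * beta))%:E)%E).
  have -> : (a ^+ (2 * beta) * T)%:E = (\int[lebesgue_measure]_(t in `[0%R, T])
      cst (a ^+ (2 * beta))%:E t)%E.
    rewrite integral_cst//= lebesgue_measure_itv/= lte_fin.
    case: ltP => [_|T00]; first by rewrite sube0.
    have -> : T = 0 by apply/eqP; rewrite eq_le T0 T00.
    by rewrite mulr0 mule0.
  apply: ge0_le_integral => //.
  - by move=> t _; rewrite lee_fin exprn_ge0.
  - apply/measurable_EFinP; apply: measurable_funS (cost_measurable x _) => //.
    by move=> t /=; rewrite !in_itv/= => /andP[->].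
  - move=> t /=; rewrite in_itv/= => tT.
    by rewrite lee_fin lerXn2r ?nnegrE ?enorm_ge0 ?aphi.
apply: ge0_subset_integral => //.
- by apply/measurable_EFinP; exact: cost_measurable.
- by move=> t _; rewrite lee_fin exprn_ge0 ?enorm_ge0.
- by move=> t /=; rewrite !in_itv/= => /andP[->].
Qed.

(** * Behaviour near the boundary *)

(** The trajectory of [l] never enters the ball of radius [eta], as otherwise
    [l] would be attracted. Comparing [enorm] with the sup norm costs a factor
    [n.+1] (nonzero even for [n = 0]), and following a neighbouring trajectory
    costs a factor [2]. *)
Lemma flow_away_from_0 (l : 'rV[R]_n) (T : R) : locally_lipschitz f ->
  ~ ROA phi l -> 0 <= T ->
  \forall x \near l, forall t, 0 <= t <= T ->
    eta / (2 * n.+1%:R) <= enorm (phi x t).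
Proof.
move=> flip lA T0; set a := eta / _.
have a0 : 0 < a by rewrite divr_gt0// mulr_gt0.
have := flow_continuous_dependence l _ _ flip T0 a0.
apply: filterS => x xl t tT; have [t0 _] := andP tT.
have etal : eta <= enorm (phi l t).
  by rewrite leNgt; apply/negP => /(enter_ball_ROA _ _ t0).
apply: le_trans (normr_le_enorm _).
have al : 2 * a <= `|phi l t|.
  rewrite (_ : 2 * a = eta / n.+1%:R).
    by rewrite ler_pdivrMr// mulrC (le_trans etal) ?enorm_le_normr.
  by rewrite /a invfM mulrCA (mulrA 2) divff ?mul1r.
have xla : `|phi x t - phi l t| <= a.
  by rewrite (le_trans (normr_le_enorm _))// ltW// xl.
have := ler_normD (phi x t) (phi l t - phi x t).
rewrite subrKC distrC; lra.
Qed.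

End Stable.
End Flow.

Theorem corollary1 (R : realType) (n : nat) (f : 'rV[R]_n -> 'rV[R]_n)
    (phi : 'rV[R]_n -> R -> 'rV[R]_n) (beta : nat) (lambda : R)
    (f0 : f 0 = 0)
    (phi_sol : is_solution_map f phi)
    (f_lip : locally_lipschitz f)
    (beta_gt0 : (0 < beta)%N)
    (lambda_gt0 : 0 < lambda)
    (H : exists r eta : R, [/\ 0 < r, 0 < eta,
           ROA phi `<=` eball 0 r & exp_stable_set phi (eball 0 eta)]) :
  (forall (x : nat -> 'rV[R]_n) (l : 'rV[R]_n),
      (forall k, ROA phi (x k)) -> x k @[k --> \oo] --> l ->
      boundary (ROA phi) l ->
      W phi lambda beta (x k) @[k --> \oo] --> (1 : R)) /\
  ROA phi = [set x | W phi lambda beta x < 1].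
Proof.
have [_ [eta [_ eta0 _ stable]]] := H.
have W_lt1 x : ROA phi x -> W phi lambda beta x < 1.
  move=> xA.
  have [I _ ->] :=
    W_ROA f phi phi_sol eta eta0 stable lambda beta x beta_gt0 xA.
  by rewrite gtrDl oppr_lt0 expR_gt0.
split; last first.
  apply/seteqP; split => x /=; first exact: W_lt1.
  move=> Wx; apply: contrapT => /(W_notin_ROA phi lambda beta).
  by apply/eqP; rewrite lt_eqF.
move=> x l xA xl [_ lint].
have lA : ~ ROA phi l.
  move=> lA; apply: lint.
  exact: (ROA_open f phi phi_sol eta eta0 stable f_lip).
apply/cvgrPdist_lt => e e0.
pose a := eta / (2 * n.+1%:R).
have a0 : 0 < a by rewrite divr_gt0// mulr_gt0.
pose c := lambda * a ^+ (2 * beta).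
have c0 : 0 < c by rewrite mulr_gt0// exprn_gt0.
have [s s0 se] : exists2 s : R, 0 <= s & expR (- s) < e.
  have /cvgr_lt/(_ _ e0) He := @cvgr_expR R.
  near (+oo : set_system R) => s; exists s; last by near: s.
  by near: s; exact: nbhs_pinfty_ge.
(* Along [x k] the cost rate is at least [c] up to time [s / c], so the
   exponent in [W] is at least [s]. *)
have T0 : 0 <= s / c by rewrite divr_ge0// ltW.
have away : \forall k \near \oo, forall t, 0 <= t <= s / c ->
    a <= enorm (phi (x k) t).
  exact: xl _ (flow_away_from_0 f phi phi_sol eta eta0 stable l _ f_lip lA T0).
apply: filterS away => k ak.
rewrite gtr0_norm ?subr_gt0 ?W_lt1//.
have := W_ROA_ge f phi phi_sol eta eta0 stable lambda beta (x k) _ a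
  (ltW lambda_gt0) beta_gt0 (xA k) T0 (ltW a0) ak.
rewrite [lambda * _]mulrA -/c [c * _]mulrC divfK ?lt0r_neq0//; lra.
Unshelve. all: by end_near. Qed.
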